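(* Let $h\ge 0$ and let $(G,D)$ be a finite $3$-transposition group of type $3^{\bullet 2h}{:}4^{\bullet 1}{:}\operatorname{SU}_{3}(2)'$. Then the diagram of $(G,D)$ has size $n=36\cdot 3^{2h}$ and spectrum $$((\,33\cdot 3^{2h}-1;\ [3^{2h}-1]^{27},\ [-3^{2h+1}-1]^{8},\ [-1]^{\star}\,)).$$
   Context: A $3$-transposition group $(G,D)$ is a group $G$ generated by a conjugacy class $D$ of elements of order $2$ such that $|de|\in\{1,2,3\}$ for all $d,e\in D$. Its diagram is the graph with vertex set $D$ in which two elements are adjacent iff their product has order $3$; its size is $n=|D|$. The spectrum is that of the $(0,1)$-adjacency matrix, written $((k;\dots,[r]^c,\dots))$: first the degree $k$ of the (regular) diagram, counted once, then the remaining eigenvalues, $[r]^c$ meaning $r$ with multiplicity $c$; if listed values coincide, their multiplicities are added, and $[r]^\star$ means that $r$ has whatever further multiplicity (possibly zero) is required for the total multiplicity to be $n$. $\operatorname{SU}_3(2)'$ is the derived group of the special unitary group of a nondegenerate hermitian form $f$ on $\mathbb{F}_4^3$; it is generated by the $3$-transposition class of the $9$ unitary transvections $x\mapsto x+f(x,v)v$, $v\ne0$ isotropic. Two $3$-transposition groups have the same central type if their quotients by their centers are isomorphic as $3$-transposition groups (matching the images of the generating classes). For a prime $p$, a $3$-transposition group $(G,D)$ has type $p^{\bullet j}{:}H$, with $(H,E)$ a $3$-transposition group, if $G$ has a normal $p$-subgroup $N$ with $|D\cap dN|=p^{j}$ for all $d\in D$ and $(G/N,DN/N)$ has the same central type as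 $(H,E)$; $4^{\bullet 1}$ stands for $2^{\bullet 2}$. Type $3^{\bullet 2h}{:}4^{\bullet 1}{:}\operatorname{SU}_3(2)'$ means type $3^{\bullet 2h}{:}H$ with $(H,E)$ of type $4^{\bullet 1}{:}\operatorname{SU}_3(2)'$. *)

(* Defs.v *)
From HB Require Import structures.
From mathcomp Require Import all_boot all_order all_algebra all_fingroup all_solvable all_field.

Set Implicit Arguments.
Unset Strict Implicit.
Unset Printing Implicit Defensive.

Import GroupScope GRing.Theory.

Section ThreeTransposition.

Variable gT : finGroupType.
Implicit Types (G : {group gT}) (D : {set gT}).

Definition is_3transposition_group G D : Prop :=
  [/\ D \in classes G,
      <<D>> = G,
      {in D, forall d, #[d] = 2}
    & {in D &, forall d e, #[d * e] \in [:: 1; 2; 3]%N}].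

Definition adjacent (d e : gT) : bool := #[d * e] == 3.

Definition diagram_mx D : 'M[algC]_#|D| :=
  (\matrix_(i, j) (adjacent (enum_val i) (enum_val j))%:R)%R.

Definition diagram_regular D (k : nat) : Prop :=
  {in D, forall d, #|[set e in D | adjacent d e]| = k}.

(* The spectrum ((k; l, [r]^star)): k is the degree, l lists pairs (eigenvalue,
   multiplicity), and r is repeated as often as needed. The number m of
   further copies of r is determined by comparing degrees, which give
   1 + \sum_(x <- l) x.2 + m = #|D|. *)
Definition diagram_spectrum D (k : nat) (l : seq (algC * nat)) (r : algC) :
    Prop :=
  diagram_regular D k /\
  exists m : nat,
    (char_poly (diagram_mx D) =
      \prod_(x <- k%:R :: tally_seq (rcons l (r, m))) ('X - x%:P))%R.

End ThreeTransposition.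

Definition same_central_type (gT hT : finGroupType)
    (G : {group gT}) (D : {set gT}) (H : {group hT}) (E : {set hT}) : Prop :=
  exists f : {morphism (G / 'Z(G)) >-> coset_of 'Z(H)},
    isom (G / 'Z(G)) (H / 'Z(H)) f /\ f @* (D / 'Z(G)) = E / 'Z(H).

(* (G, D) has type p^{bullet j}:(H, E); both pairs are meant to be 3-transposition
   groups. *)
Definition has_type (p j : nat) (gT hT : finGroupType)
    (G : {group gT}) (D : {set gT}) (H : {group hT}) (E : {set hT}) : Prop :=
  prime p /\
  exists N : {group gT},
    [/\ N <| G,
        p.-group N,
        {in D, forall d, #|D :&: (d *: N)| = (p ^ j)%N}
      & same_central_type (G / N)%G (D / N) H E].

Section SpecialUnitary.

Variables (F : finFieldType) (theta : {rmorphism F -> F}).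
Variable f : {hermitian_sym 'rV[F]_3 for theta}%R.

(* Matrices act on row vectors from the right. *)
Definition SU3 : {set {'GL_3[F]}} :=
  [set g : {'GL_3[F]} | (\det (GLval g) == 1)%R &
    [forall x : 'rV[F]_3, forall y : 'rV[F]_3,
      f (x *m GLval g)%R (y *m GLval g)%R == f x y]].

Lemma SU3_group_set : group_set SU3.
Proof.
apply/group_setP; split=> [|g h].
  rewrite inE /= det1 eqxx /=.
  by apply/forallP=> x; apply/forallP=> y; rewrite !mulmx1.
rewrite !inE => /andP[/eqP dg /forallP fg] /andP[/eqP dh /forallP fh].
rewrite /= det_mulmx dg dh mulr1 eqxx /=.
apply/forallP=> x; apply/forallP=> y; rewrite !mulmxA.
by rewrite (eqP (forallP (fh _) _)) (eqP (forallP (fg _) _)).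
Qed.

Canonical SU3_group := Group SU3_group_set.

Definition unitary_transvections : {set {'GL_3[F]}} :=
  [set t : {'GL_3[F]} | [exists v : 'rV[F]_3,
    [&& (v != 0)%R, (f v v == 0)%R &
      [forall x : 'rV[F]_3, (x *m GLval t == x + f x v *: v)%R]]]].

End SpecialUnitary.

(* Main.v *)
Require Import Defs.
From mathcomp Require Import all_boot all_order all_algebra all_fingroup all_solvable all_field.
From mathcomp Require Import ring zify.
Import GroupScope GRing.Theory.

(** The nine unitary transvections are pairwise adjacent, also modulo the
    center of [SU_3(2)']. Passing to a central quotient changes neither the
    vertices nor the edges of the diagram of a 3-transposition group, and a
    normal [p]-subgroup replaces each vertex by a block of [p^j] vertices,
    blocks inheriting the adjacency of the quotient, with no edge inside a block
    for [p = 2] and all edges for [p = 3]. Hence, with [q = 3^(2h)], the vertices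
    fall into 9 classes of [4] blocks of [q] vertices, and two vertices are
    adjacent iff they lie in different classes or are distinct in the same block.
    If [J], [K], [B] are the all-ones matrix and the indicators of the classes
    and of the blocks, the adjacency matrix is [J - K + B - 1]. The matrices
    [J / 36q], [K / 4q], [B / q], [1] are nested idempotents of traces 1, 9, 36
    and [36q], so their successive differences decompose the space into
    eigenspaces. *)

Set Implicit Arguments.
Unset Strict Implicit.
Unset Printing Implicit Defensive.

(** * Spectra from orthogonal idempotents *)

Section SpectralDecomposition.
Local Open Scope ring_scope.

(** Sylvester's determinant identity: a single block matrix factors in two ways into block
    triangular matrices, one exposing each side. *)
Lemma det_1add_mulmxC (R : comNzRingType) m n (A : 'M[R]_(m, n)) (B : 'M[R]_(n, m)) :
  \det (1%:M + A *m B) = \det (1%:M + B *m A).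
Proof.
have e1 : block_mx 1%:M (- A) B 1%:M =
          block_mx 1%:M 0 B 1%:M *m block_mx 1%:M (- A) 0 (1%:M + B *m A).
  rewrite mulmx_block !(mul1mx, mulmx1, mul0mx, mulmx0, addr0) mulmxN.
  by rewrite [1%:M + _]addrC addKr.
have e2 : block_mx 1%:M (- A) B 1%:M =
          block_mx 1%:M (- A) 0 1%:M *m block_mx (1%:M + A *m B) 0 B 1%:M.
  by rewrite mulmx_block !(mul1mx, mulmx1, mul0mx, mulmx0, add0r) mulNmx addrK.
have := congr1 determinant e1; rewrite e2 !det_mulmx !det_ublock !det_lblock.
by rewrite !det1 !mul1r !mulr1.
Qed.

(** With the rank factorization [P = C *m R], idempotence reads [C R C R = C R]; [C] cancels on the
    left and [R] on the right because both have full rank. *)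
Lemma idempotent_base (F : fieldType) n (P : 'M[F]_n) :
  P *m P = P -> row_base P *m col_base P = 1%:M.
Proof.
move=> PP; apply: (row_full_inj (col_base_full P)).
apply: (row_free_inj (row_base_free P)).
by rewrite /= mulmx1 mulmxA mulmx_base -mulmxA mulmx_base PP.
Qed.

(** Sylvester's identity moves the determinant to a scalar matrix of size [\rank P], and in
    characteristic 0 the trace of an idempotent determines its rank. *)
Lemma det_1add_scale_idempotent (F : numFieldType) n (P : 'M[F]_n) (r : nat)
    (c : {poly F}) :
  P *m P = P -> \tr P = r%:R ->
  \det (1%:M + c *: map_mx polyC P) = (1 + c) ^+ r.
Proof.
move=> /idempotent_base PP trP.
have -> : r = \rank P.
  apply/eqP; rewrite -(Num.Theory.eqr_nat F) -trP -{1}(mulmx_base P) mxtrace_mulC PP.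
  by rewrite mxtrace1.
rewrite -{1}(mulmx_base P) map_mxM scalemxAl det_1add_mulmxC -scalemxAr -map_mxM PP.
by rewrite map_mx1 -[X in X + _]scale1r -scalerDl scalemx1 det_scalar.
Qed.

(** By orthogonality [1 + \sum c_i P_i] is the product of the factors [1 + c_i P_i], split off one
    at a time. *)
Lemma det_1add_sum_idempotents (F : numFieldType) n (I : eqType) (s : seq I)
    (P : I -> 'M[F]_n) (r : I -> nat) (c : I -> {poly F}) :
    uniq s ->
    {in s, forall i, P i *m P i = P i /\ \tr (P i) = (r i)%:R} ->
    {in s &, forall i j, i != j -> P i *m P j = 0} ->
  \det (1%:M + \sum_(i <- s) c i *: map_mx polyC (P i)) =
    \prod_(i <- s) (1 + c i) ^+ r i.
Proof.
elim: s => [|i s IH] /=; first by rewrite !big_nil addr0 det1.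
case/andP=> is_s us PP Pij; rewrite !big_cons.
have [PPi tri] := PP i (mem_head _ _).
rewrite -(det_1add_scale_idempotent (c i) PPi tri) -IH //; last 2 first.
- by move=> j js; apply: PP; rewrite inE js orbT.
- by move=> j k js ks; apply: Pij; rewrite inE ?js ?ks orbT.
rewrite -det_mulmx mulmxDl !mul1mx mulmxDr mulmx1.
suff -> : c i *: map_mx polyC (P i) *m \sum_(j <- s) c j *: map_mx polyC (P j) = 0.
  by rewrite addr0 addrA addrAC.
rewrite mulmx_sumr big_seq big1 // => j js.
rewrite -scalemxAl -scalemxAr -map_mxM Pij ?map_mx0 ?scaler0 //.
- exact: mem_head.
- by rewrite inE js orbT.
- by apply: contraNneq is_s => ->.
Qed.

(** Since the [P i] sum to 1, the characteristic matrix is [\sum ('X - a_i) P_i = 1 + \sum ('X - a_i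
    - 1) P_i]. *)
Lemma char_poly_sum_idempotents (F : numFieldType) n (I : eqType) (s : seq I)
    (P : I -> 'M[F]_n) (r : I -> nat) (a : I -> F) :
    uniq s ->
    {in s, forall i, P i *m P i = P i /\ \tr (P i) = (r i)%:R} ->
    {in s &, forall i j, i != j -> P i *m P j = 0} ->
    \sum_(i <- s) P i = 1%:M ->
  char_poly (\sum_(i <- s) a i *: P i) = \prod_(i <- s) ('X - (a i)%:P) ^+ r i.
Proof.
move=> us PP Pij sumP.
have -> : \prod_(i <- s) ('X - (a i)%:P) ^+ r i =
          \prod_(i <- s) (1 + ('X - (a i)%:P - 1)) ^+ r i.
  by apply: eq_bigr => i _; rewrite [1 + _]addrC subrK.
rewrite -(det_1add_sum_idempotents _ us PP Pij) {us PP Pij}/char_poly; congr (\det _).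
rewrite /char_poly_mx -(map_mx1 polyC) -sumP -scalemx1 -(map_mx1 polyC) -sumP.
rewrite !map_mx_sum /= scaler_sumr -sumrB -big_split /=; apply: eq_bigr => i _.
by rewrite map_mxZ !scalerBl scale1r [RHS]addrC subrK.
Qed.

(** Successive differences of a chain of nested idempotents are orthogonal idempotents, and their
    sum telescopes to 1. *)
Lemma char_poly_nested_idempotents (F : numFieldType) n k (e : nat -> 'M[F]_n)
    (r : nat -> nat) (a : nat -> F) :
    e 0 = 0 -> e k = 1%:M ->
    {homo e : i j / i <= j >-> i *m j = i /\ j *m i = i}%N ->
    (forall i, i < k -> \tr (e i.+1 - e i) = (r i)%:R)%N ->
  char_poly (\sum_(0 <= i < k) a i *: (e i.+1 - e i)) =
    \prod_(0 <= i < k) ('X - (a i)%:P) ^+ r i.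
Proof.
move=> e0 ek ee tre; apply: char_poly_sum_idempotents; first exact: iota_uniq.
- move=> i; rewrite mem_index_iota /= => ik; split; last exact: tre.
  rewrite mulmxBl !mulmxBr (ee _ _ (leqnn i.+1)).1 (ee _ _ (leqnSn i)).1.
  by rewrite (ee _ _ (leqnSn i)).2 (ee _ _ (leqnn i)).1 subrr subr0.
- move=> i j _ _; rewrite neq_ltn => /orP[] ij.
  + rewrite mulmxBl !mulmxBr (ee _ _ (leqW ij)).1 (ee _ _ ij).1.
    by rewrite (ee _ _ (leqW (ltnW ij))).1 (ee _ _ (ltnW ij)).1 !subrr.
  + rewrite mulmxBl !mulmxBr (ee _ _ (leqW ij)).2 (ee _ _ (leqW (ltnW ij))).2.
    by rewrite (ee _ _ ij).2 (ee _ _ (ltnW ij)).2 !subrr.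
- by rewrite telescope_sumr // e0 ek subr0.
Qed.

(** * Averaging over the classes of an equivalence relation *)

Lemma equivalence_rel_sym (T : Type) (E : rel T) :
  equivalence_rel E -> symmetric E.
Proof.
case/equivalence_relP=> Exx transE x y.
by apply/idP/idP=> /transE <-; exact: Exx.
Qed.

Definition rel_mx (F : numFieldType) n (E : rel 'I_n) : 'M[F]_n :=
  \matrix_(i, j) (E i j)%:R.

(** The entries of [rel_mx F E] are constant along [E']-classes, so averaging over these classes
    fixes it. The free scalar [x] lets one statement cover every nested pair of averages, including
    an average with itself. *)
Lemma mul_avg_rel_mx (F : numFieldType) n (E E' : rel 'I_n) (c : nat) (x : F) :
    equivalence_rel E -> equivalence_rel E' -> subrel E' E ->
    (0 < c)%N -> (forall i, #|[pred j | E' i j]| = c) ->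
  (x *: rel_mx F E) *m (c%:R^-1 *: rel_mx F E') = x *: rel_mx F E /\
  (c%:R^-1 *: rel_mx F E') *m (x *: rel_mx F E) = x *: rel_mx F E.
Proof.
move=> eqE eqE' sE c_gt0 cardE'.
have cF : c%:R != 0 :> F by rewrite Num.Theory.pnatr_eq0 -lt0n.
have symE := equivalence_rel_sym eqE; have symE' := equivalence_rel_sym eqE'.
have transE : left_transitive E by case/equivalence_relP: eqE.
have trR (S : rel 'I_n) : symmetric S -> (rel_mx F S)^T = rel_mx F S.
  by move=> symS; apply/matrixP=> i j; rewrite !mxE symS.
have EE' : rel_mx F E' *m rel_mx F E = c%:R *: rel_mx F E.
  apply/matrixP=> i j; rewrite !mxE -(cardE' i) -sum1_card natr_sum.
  rewrite mulr_suml [RHS]big_mkcond; apply: eq_bigr => l _.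
  rewrite !mxE inE; case: ifP => [il|_]; last by rewrite mul0r.
  by rewrite (transE _ _ (sE _ _ il)).
have EE'r : rel_mx F E *m rel_mx F E' = c%:R *: rel_mx F E.
  by rewrite -[LHS]trmxK trmx_mul !trR // EE' linearZ /= trR.
rewrite -!scalemxAl -!scalemxAr EE' EE'r; split; first by rewrite scalerK.
by rewrite !scalerA mulrAC mulVf ?mul1r.
Qed.

Lemma mxtrace_rel_mx (F : numFieldType) n (E : rel 'I_n) :
  equivalence_rel E -> \tr (rel_mx F E) = n%:R.
Proof.
move=> /equivalence_relP[Exx _]; rewrite /mxtrace.
under eq_bigr do rewrite mxE Exx.
by rewrite sumr_const card_ord.
Qed.

Lemma char_poly_three_equivalences (F : numFieldType) n (q : nat)
   (K B : rel 'I_n) :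
   (0 < q)%N -> n = (36 * q)%N ->
   equivalence_rel K -> equivalence_rel B -> subrel B K ->
   (forall i, #|[pred j | K i j]| = 4 * q)%N ->
   (forall i, #|[pred j | B i j]| = q)%N ->
  char_poly (\matrix_(i, j) ((i != j) && (B i j || ~~ K i j))%:R : 'M[F]_n) =
   ('X - (33 * q%:R - 1)%:P) * ('X - (- 3 * q%:R - 1)%:P) ^+ 8 *
   ('X - (q%:R - 1)%:P) ^+ 27 * ('X - (- 1)%:P) ^+ (n - 36).
Proof.
move=> q_gt0 nE eqK eqB sBK cK cB.
have qF : q%:R != 0 :> F by rewrite Num.Theory.pnatr_eq0 -lt0n.
pose J : rel 'I_n := fun _ _ => true.
pose I : rel 'I_n := fun i j => i == j.
(* The defaults supply the last member of the chain: from index 3 on the relation is equality, with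
   classes of size 1. *)
pose R := nth I [:: J; K; B]; pose c := nth 1%N [:: (36 * q)%N; (4 * q)%N; q].
have eqR i : equivalence_rel (R i).
  move: i => [|[|[|i]]] //; rewrite /R /= nth_nil => x y z.
  by rewrite /I eqxx; split=> // /eqP->.
have c_gt0 i : (0 < c i)%N.
  by move: i => [|[|[|i]]]; rewrite /c /= ?nth_nil ?muln_gt0.
have cR i x : #|[pred y | R i x y]| = c i.
  move: i => [|[|[|i]]]; rewrite /c /R /=; [|exact: cK|exact: cB|].
    by rewrite -nE -[RHS]card_ord.
  by rewrite !nth_nil -(card1 x); apply: eq_card => y; rewrite !inE eq_sym.
have sIB : subrel I B by move=> i j /eqP->; case: (eqB j j j).
have sR i j : (i <= j)%N -> subrel (R j) (R i).
  move: i j => [|[|[|i]]] [|[|[|j]]] // _; rewrite /R /= ?nth_nil //.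
  by move=> x y /sIB /sBK.
(* The index is shifted by one to start the chain at 0: [e 1], ..., [e 4] are [J / 36q], [K / 4q],
   [B / q] and 1. *)
pose e i : 'M[F]_n := if i is i'.+1 then (c i')%:R^-1 *: rel_mx F (R i') else 0.
have ee : {homo e : i j / (i <= j)%N >-> i *m j = i /\ j *m i = i}.
  move=> [|i] [|j] //; rewrite ?mul0mx ?mulmx0 // ltnS => ij.
  by apply: mul_avg_rel_mx => //; apply: sR.
have e4 : e 4 = 1%:M.
  by rewrite /e /c /R /= invr1 scale1r; apply/matrixP=> i j; rewrite !mxE.
(* The matrix is [36q e_1 - 4q e_2 + q e_3 - e_4]; its eigenvalue on [e_(i+1) - e_i] is the sum of
   the coefficients from [e_(i+1)] on. The multiplicities [r] are the differences of the traces 0,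
   1, 9, 36, n. *)
pose a := nth 0 [:: 33 * q%:R - 1; - 3 * q%:R - 1; q%:R - 1; - 1] : nat -> F.
pose r := nth 0%N [:: 1; 8; 27; n - 36]%N.
have tre i : (i < 4)%N -> \tr (e i.+1 - e i) = (r i)%:R.
  move: i => [|[|[|[|i]]]] // _; rewrite !linearB /= ?linearZ /= ?mxtrace0;
    rewrite !mxtrace_rel_mx // /c /r /=.
  - rewrite nE natrM; field; exact: qF.
  - rewrite nE !natrM; field; exact: qF.
  - rewrite nE !natrM; field; exact: qF.
  - rewrite natrB ?nE ?natrM; last by rewrite leq_pmulr.
    field; exact: qF.
have := char_poly_nested_idempotents a (erefl : e 0 = 0) e4 ee tre.
rewrite unlock /= /r /a /= mulr1 expr1 !mulrA => <-; congr char_poly.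
apply/matrixP=> i j; rewrite !mxE /R /J /= /c /= /I !natrM.
have [<-|_] := eqVneq i j.
  by rewrite (sBK i i) (sIB i i) ?/I //=; field; exact: qF.
case: (boolP (B i j)) => [/sBK ->|_] /=; first by field; exact: qF.
by case: (K i j) => /=; field; exact: qF.
Qed.
End SpectralDecomposition.

Lemma card_enum_val_pred (T : finType) (D : {set T}) (P : pred T) :
  #|[pred j : 'I_#|D| | P (enum_val j)]| = #|[set e in D | P e]|.
Proof.
rewrite -[LHS]sum1_card -[RHS]sum1_card.
rewrite (eq_bigl (fun e => (e \in D) && P e)) => [|e]; last by rewrite inE.
by rewrite big_enum_val_cond; apply: eq_bigl => i; rewrite inE.
Qed.

Lemma prod_tally_seq (R : pzSemiRingType) (T : eqType) (F : T -> R) (l : seq (T * nat)) :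
  (\prod_(x <- tally_seq l) F x = \prod_(p <- l) F p.1 ^+ p.2)%R.
Proof.
rewrite /tally_seq big_flatten big_map /=.
by apply: eq_bigr => p _; rewrite big_nseq iter_mulr_1.
Qed.

(** * Diagrams of 3-transposition groups *)

Section ThreeTranspositionGroups.
Variables (gT : finGroupType).
Implicit Types (G N : {group gT}) (D : {set gT}).

Lemma sub_3transposition_group G D : is_3transposition_group G D -> D \subset G.
Proof. by case=> _ <- _ _; apply: subset_gen. Qed.

Lemma involution_mulg (x : gT) : #[x] = 2 -> x * x = 1.
Proof. by move=> x2; rewrite -(expg_order x) x2. Qed.

Lemma involution_inv (x : gT) : #[x] = 2 -> x^-1 = x.
Proof. by move=> /involution_mulg xx; apply/eqP; rewrite eq_invg_mul xx. Qed.

(** If [e = d * z] with [z] central and nontrivial, then [z] has order 2 and [d] commutes with all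
    of [D]; so [d] is central and equals its conjugate [e]. *)
Lemma coset_center_inj G D :
  is_3transposition_group G D -> {in D &, injective (coset 'Z(G))}.
Proof.
move=> trG d e Dd De; have sDG := sub_3transposition_group trG.
case: trG => /imsetP[x Gx defD] genD D2 D3.
have nZ y : y \in D -> y \in 'N('Z(G)).
  by move=> /(subsetP sDG); apply: (subsetP (normal_norm (center_normal G))).
move/(rcoset_kercosetP (nZ _ Dd) (nZ _ De)); rewrite mem_rcoset => Zde.
pose z := d * e; have {Zde} Zz : z \in 'Z(G).
  by rewrite /z -(involution_inv (D2 _ De)).
have cz y : y \in G -> commute z y by case/centerP: Zz => _; apply.
have Ee : e = d * z by rewrite /z mulgA involution_mulg ?mul1g ?D2.
have zz : z * z = 1.
  have := involution_mulg (D2 _ De); rewrite {1 2}Ee -mulgA (mulgA z).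
  by rewrite (cz _ (subsetP sDG _ Dd)) !mulgA involution_mulg ?mul1g ?D2.
have [z1 | nz1] := eqVneq z 1; first by rewrite Ee z1 mulg1.
have z2 : #[z] = 2 by apply: nt_prime_order; rewrite // expgS expg1.
(* An f adjacent to d would give the element e f = z (d f) of order 6. *)
have comm f : f \in D -> commute d f.
  move=> Df; have := D3 _ _ Dd Df; set w := d * f => w3.
  suff ww : w * w = 1.
    have /eqP := ww; rewrite -eq_invg_mul /w invMg !involution_inv ?D2 //.
    by move=> /eqP/esym.
  have := w3; rewrite !inE => /or3P[||/eqP w_3].
  - by rewrite order_eq1 => /eqP->; rewrite mulg1.
  - by move=> /eqP /involution_mulg.
  have cwz : commute z w by apply: cz; rewrite groupM ?(subsetP sDG).
  have := D3 _ _ De Df; rewrite Ee -(cz d) ?(subsetP sDG) // -mulgA -/w.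
  by rewrite orderM ?z2 ?w_3.
have /imsetP[y Gy ->] : e \in d ^: G.
  by rewrite defD in Dd De; rewrite (class_eqP Dd).
suff /centP/(_ _ Gy) dy : d \in 'C(G) by rewrite conjgE dy mulKg.
by rewrite -genD cent_gen; apply/centP=> f; apply: comm.
Qed.

(** Since [D] is one class and [N] is normal, either all of [D] lies in [N] or none of it does; in
    the latter case the images keep order 2. *)
Lemma quotient_3transposition_group G D N :
    is_3transposition_group G D -> N <| G -> ~~ (D \subset N) ->
  is_3transposition_group (G / N)%G (D / N).
Proof.
move=> trG nNG sDN; have sDG := sub_3transposition_group trG.
have sGN := normal_norm nNG; have sDNN := subset_trans sDG sGN.
case: trG => /imsetP[x Gx defD] genD D2 D3.
have DN y : y \in D -> coset N y != 1.
  move=> Dy; apply: contra sDN => /eqP/coset_idr Ny.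
  rewrite defD in Dy *; rewrite -(class_eqP Dy).
  by rewrite class_sub_norm // Ny // (subsetP sDNN) // defD.
split.
- by rewrite defD quotientE morphim_class ?(subsetP sGN) // mem_classes // mem_quotient.
- by rewrite -quotient_gen ?genD.
- move=> _ /morphimP[y Ny Dy ->]; have := morph_order (coset_morphism N) Ny.
  rewrite D2 //= dvdn_divisors // !inE => /orP[|/eqP //].
  by rewrite order_eq1 (negPf (DN _ Dy)).
- move=> _ _ /morphimP[y Ny Dy ->] /morphimP[z Nz Dz ->].
  rewrite -morphM //; have := morph_order (coset_morphism N) (groupM Ny Nz).
  have := D3 _ _ Dy Dz; rewrite !inE => /or3P[]/eqP->.
  + by rewrite dvdn1 => ->.
  + by rewrite dvdn_divisors // !inE => /orP[]->; rewrite ?orbT.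
  + by rewrite dvdn_divisors // !inE => /orP[]->; rewrite ?orbT.
Qed.

(** The order of the image divides 1, 2 or 3 and is not 1 as the two images are distinct involutive
    elements, so it cannot drop. *)
Lemma order_mul_involutions (rT : finGroupType) G (phi : gT -> rT) (d e : gT) :
    {in G &, {morph phi : x y / x * y}} -> d \in G -> e \in G ->
    #[d] = 2 -> #[e] = 2 -> #[d * e] \in [:: 1; 2; 3]%N -> phi d != phi e ->
  #[phi d * phi e] = #[d * e].
Proof.
move=> phiM Gd Ge d2 e2 de3 phi_de.
have dvd_order := morph_order (Morphism phiM).
have phi_inv : (phi d)^-1 = phi d.
  apply/eqP; rewrite eq_invg_mul -phiM // involution_mulg //.
  by have := morph1 (Morphism phiM) => /= ->.
have: #[phi d * phi e] != 1%N.
  by rewrite order_eq1 -eq_invg_mul phi_inv.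
have := dvd_order _ (groupM Gd Ge); rewrite /= phiM //.
move: de3; rewrite !inE => /or3P[]/eqP->; rewrite ?dvdn1; first by move=> ->.
- by rewrite dvdn_divisors // !inE => /orP[->|/eqP->].
- by rewrite dvdn_divisors // !inE => /orP[->|/eqP->].
Qed.
End ThreeTranspositionGroups.

(** Translates a type into a map on vertices: blocks are the fibres, products across blocks keep
    their order, and products inside a block are [p]-elements. The bound on [E / 'Z(H)] excludes
    [D \subset N], where all of [D] would collapse to one point. *)
Lemma has_type_quotient (gT hT : finGroupType) (p j : nat)
    (G : {group gT}) (D : {set gT}) (H : {group hT}) (E : {set hT}) :
    is_3transposition_group G D -> has_type p j G D H E ->
    (1 < #|E / 'Z(H)|)%N ->
  exists phi : gT -> coset_of 'Z(H),
    [/\ phi @: D = E / 'Z(H),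
        {in D, forall d, #|[set e in D | phi e == phi d]| = (p ^ j)%N},
        {in D &, forall d e, phi d != phi e -> #[phi d * phi e] = #[d * e]}
      & {in D &, forall d e, phi d = phi e -> p.-elt (d * e)}].
Proof.
move=> trG [_ [N [nNG pN fibN [f [isof imD]]]]] ltE.
have sDG := sub_3transposition_group trG.
have sGN := normal_norm nNG; have sDN := subset_trans sDG sGN.
set Z := 'Z(G / N) in f isof imD.
have sGZ : G / N \subset 'N(Z) := normal_norm (center_normal (G / N)).
pose phi x := f (coset Z (coset N x)).
have phiG x : x \in G -> coset Z (coset N x) \in (G / N) / Z.
  by move=> Gx; rewrite !mem_quotient.
have phiM : {in G &, {morph phi : x y / x * y}}.
  move=> x y Gx Gy; rewrite /phi !morphM ?phiG ?(subsetP sGN) //;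
  by rewrite (subsetP sGZ) ?mem_quotient.
have imphi : phi @: D = E / 'Z(H).
  rewrite -imD morphimEsub ?quotientS // quotientE morphimEsub; last first.
    exact: subset_trans (quotientS N sDG) sGZ.
  by rewrite quotientE morphimEsub // -!imset_comp.
have nDN : ~~ (D \subset N).
  apply: contraL ltE => sDN1; rewrite -leqNgt -imphi.
  suff /subset_leq_card : phi @: D \subset [set f 1] by rewrite cards1.
  apply/subsetP=> _ /imsetP[x Dx ->].
  by rewrite inE /phi (coset_id (subsetP sDN1 _ Dx)) morph1.
have trGN := quotient_3transposition_group trG nNG nDN.
(* The isomorphism and the passage modulo the center of [G / N] are injective on the image of [D],
   so only [N] identifies vertices. *)
have phiP : {in D &, forall d e, (phi d == phi e) = (e \in d *: N)}.
  move=> d e Dd De; have [Nd Ne] := (subsetP sDN _ Dd, subsetP sDN _ De).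
  have [Gd Ge] := (subsetP sDG _ Dd, subsetP sDG _ De).
  rewrite -norm_rlcoset // eq_sym; apply/eqP/idP => [|/(rcoset_kercosetP Ne Nd)].
    move/(injmP (isom_inj isof)); rewrite !phiG // => /(_ isT isT).
    move/(coset_center_inj trGN); rewrite quotientE !mem_morphim // => /(_ isT isT).
    by move/(rcoset_kercosetP Ne Nd).
  by rewrite /phi => ->.
case: trG => _ _ D2 D3; exists phi; split=> // [d Dd|d e Dd De|d e Dd De].
- rewrite -(fibN d Dd); apply: eq_card => e; rewrite !inE.
  by case De: (e \in D) => //=; rewrite eq_sym phiP.
- move=> de; apply: (order_mul_involutions phiM) => //;
  by [apply: (subsetP sDG) | apply: D2 | apply: D3].
- move/eqP; rewrite phiP // mem_lcoset involution_inv ?D2 //.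
  exact: mem_p_elt.
Qed.

Lemma card_fibres (aT rT : finType) (phi : aT -> rT) (D : {set aT}) (c : nat) :
  {in D, forall d, #|[set e in D | phi e == phi d]| = c} ->
  #|D| = (#|phi @: D| * c)%N.
Proof.
move=> fib; rewrite -sum1_card (partition_big_imset phi) -sum_nat_const.
apply: eq_bigr => _ /imsetP[d Dd ->]; rewrite -(fib d Dd) -sum1_card.
by apply: eq_bigl => e; rewrite inE.
Qed.

(** Each value in [E / 'Z(H)] has a unique representative in [E], so the map can be lifted to [E]
    itself and then composed with a further such map out of [E]. *)
Lemma has_type_lift (gT hT : finGroupType) (p j : nat)
    (G : {group gT}) (D : {set gT}) (H : {group hT}) (E : {set hT}) :
    is_3transposition_group G D -> is_3transposition_group H E ->
    has_type p j G D H E -> (1 < #|E|)%N ->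
  exists phi : gT -> hT,
    [/\ phi @: D = E,
        {in D, forall d, #|[set e in D | phi e == phi d]| = (p ^ j)%N},
        {in D &, forall d e, phi d != phi e -> #[phi d * phi e] = #[d * e]}
      & {in D &, forall d e, phi d = phi e -> p.-elt (d * e)}].
Proof.
move=> trG trH tyG ltE; have sEH := sub_3transposition_group trH.
have injE := coset_center_inj trH.
have sHN : H \subset 'N('Z(H)) := normal_norm (center_normal H).
have EZ : E / 'Z(H) = coset 'Z(H) @: E.
  by rewrite quotientE morphimEsub // (subset_trans sEH).
have [|phi [im fib ord elt]] := has_type_quotient trG tyG.
  by rewrite EZ card_in_imset.
pose eta d := odflt 1 [pick e in E | coset 'Z(H) e == phi d].
have etaP d : d \in D -> eta d \in E /\ coset 'Z(H) (eta d) = phi d.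
  move=> Dd; rewrite /eta; case: pickP => [e /andP[Ee /eqP] //|/= noE].
  have : phi d \in E / 'Z(H) by rewrite -im imset_f.
  by rewrite EZ => /imsetP[e Ee de]; have := noE e; rewrite Ee de eqxx.
have eta_eq d e : d \in D -> e \in D -> (eta d == eta e) = (phi d == phi e).
  move=> /etaP[Ed <-] /etaP[Ee <-]; apply/eqP/eqP => [-> //|]; exact: injE.
exists eta; split.
- apply/setP=> e; apply/imsetP/idP => [[d /etaP[Ed _] -> //]|Ee].
  have : coset 'Z(H) e \in phi @: D by rewrite im EZ imset_f.
  case/imsetP=> d Dd de; exists d => //; have [Ed cd] := etaP d Dd.
  by apply: injE => //; rewrite cd.
- move=> d Dd; rewrite -(fib d Dd); apply: eq_card => e; rewrite !inE.
  by case De: (e \in D) => //=; rewrite eta_eq.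
- move=> d e Dd De; rewrite eta_eq // => de; rewrite -(ord d e) //.
  have [[Ed cd] [Ee ce]] := (etaP d Dd, etaP e De).
  have [_ _ E2 E3] := trH; rewrite -cd -ce.
  symmetry; apply: (order_mul_involutions (G := H)); rewrite ?cd ?ce //;
    by [move=> x y Hx Hy; rewrite morphM ?(subsetP sHN) | apply: (subsetP sEH)
       | apply: E2 | apply: E3].
- by move=> d e Dd De /eqP; rewrite eta_eq // => /eqP; apply: elt.
Qed.

(** * Braiding involutions modulo the center of the derived group *)

Section BraidingInvolutions.
Variables (gT : finGroupType) (S : {group gT}) (T : {set gT}).
Hypotheses (sTS : T \subset S) (T2 : {in T, forall t, t * t = 1})
  (T3 : {in T &, forall t s, t != s -> t * s * t = s * t * s})
  (T4 : {in T &, forall t s, t != s -> exists2 r, r \in T & t * s * r != r * s * t}).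

Let TV t : t \in T -> t^-1 = t.
Proof. by move=> Tt; apply/eqP; rewrite eq_invg_mul T2. Qed.

(** The braid relation says that [s * t] conjugates [t] to [s], so [t * s] is the commutator of [t]
    and [s * t]. *)
Lemma mul_braiding_involutions_der1 : {in T &, forall t s, t * s \in S^`(1)}.
Proof.
move=> t s Tt Ts; have [->|ts] := eqVneq t s; first by rewrite T2.
suff -> : t * s = [~ t, s * t] by rewrite mem_commg ?groupM ?(subsetP sTS).
rewrite commgEl conjgE invMg !TV //; congr (_ * _).
by rewrite !mulgA T3 // -!mulgA (mulgA s s) !T2 // mul1g T2 ?mulg1.
Qed.

(** If [t * s] were central in the derived group, it would commute with [r * t], giving
    [t * s * r = r * s * t] against [T4]. Hence distinct involutions stay distinct, and the braid
    relation makes the cube of their product trivial. *)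
Lemma quotient_center_der1_braiding :
  #|T / 'Z(S^`(1))| = #|T| /\
  {in T / 'Z(S^`(1)) &, forall c d, c != d -> #[c * d] = 3}.
Proof.
set Z := 'Z(S^`(1)).
have nZS : S \subset 'N(Z).
  by apply: normal_norm (char_normal_trans (center_char _) (der_normal 1 S)).
have sTN := subset_trans sTS nZS; have nT t : t \in T -> t \in 'N(Z) := subsetP sTN t.
have notZ : {in T &, forall t s, t != s -> t * s \notin Z}.
  move=> t s Tt Ts /(T4 Tt Ts)[r Tr]; apply: contra => /centerP[_ cts].
  have := cts _ (mul_braiding_involutions_der1 Tr Tt); rewrite /commute -!mulgA.
  rewrite (mulgA t t) T2 // mul1g => /(congr1 (mulg^~ t)).
  by rewrite -!mulgA T2 // mulg1 => ->.
have injZ : {in T &, injective (coset Z)}.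
  move=> t s Tt Ts /(rcoset_kercosetP (nT _ Tt) (nT _ Ts)).
  by rewrite mem_rcoset TV // => Zts; apply: contraTeq Zts; apply: notZ.
split; first by rewrite quotientE morphimEsub // card_in_imset.
move=> _ _ /morphimP[t Nt Tt ->] /morphimP[s Ns Ts ->] ts.
have {}ts : t != s by apply: contraNneq ts => ->.
rewrite -morphM //; apply: nt_prime_order => //.
  rewrite -morphX ?groupM // !expgS expg0 mulg1 !mulgA T3 // -!mulgA.
  by rewrite (mulgA s s) T2 // mul1g (mulgA t t) T2 // mul1g T2 // morph1.
apply: contra (notZ t s Tt Ts ts) => /eqP.
by apply: coset_idr; rewrite groupM.
Qed.
End BraidingInvolutions.

(** * Unitary transvections over the field of order 4 *)

Lemma eq_mulmx_rV (R : pzRingType) m n (A B : 'M[R]_(m, n)) :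
  (forall x : 'rV[R]_m, x *m A = x *m B)%R -> A = B.
Proof. by move=> AB; apply/row_matrixP=> i; rewrite !rowE AB. Qed.

Section FieldOfOrder4.
Local Open Scope ring_scope.
Variables (F : finFieldType) (cardF : #|F| = 4%N).
Implicit Types (a b c : F).

Lemma F4_exp4 a : a ^+ 4 = a. Proof. by rewrite -cardF expf_card. Qed.

Lemma F4_exp3 a : a != 0 -> a ^+ 3 = 1.
Proof. by move=> a0; apply: (mulfI a0); rewrite -exprS F4_exp4 mulr1. Qed.

Lemma F4_pchar2 : 2%N \in [pchar F].
Proof.
have := F4_exp4 (-1); rewrite -signr_odd expr0 => e1.
by rewrite inE /= -[2%:R]/(1 + 1) addr_eq0 {1}e1.
Qed.

(** Any element other than 0 and 1 is a primitive cube root of unity. It supplies the trace 1 used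
    to make character sums vanish. *)
Lemma F4_trace1 : exists c : F, c + c ^+ 2 = 1.
Proof.
have [c c0 c1] : exists2 c : F, c != 0 & c != 1.
  have : (0 < #|~: [set (0 : F)%R; 1%R]|)%N.
    by rewrite cardsCs setCK cardF cards2 eq_sym oner_eq0.
  by case/card_gt0P=> c; rewrite !inE negb_or => /andP[]; exists c.
exists c; have : (c - 1) * (c + c ^+ 2 - 1) = 0.
  have -> : (c - 1) * (c + c ^+ 2 - 1) = c ^+ 3 - 1 - 2%:R * (c - 1) by ring.
  by rewrite F4_exp3 // (pcharf0 F4_pchar2) mul0r !subrr.
by move/eqP; rewrite mulf_eq0 !subr_eq0 (negPf c1) /= => /eqP.
Qed.
End FieldOfOrder4.

Section Transvections.
Local Open Scope ring_scope.
Variables (F : finFieldType) (cardF : #|F| = 4%N).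
Variables (theta : {rmorphism F -> F}) (thetaE : forall a : F, theta a = a ^+ 2).
Variables (f : {hermitian_sym 'rV[F]_3 for theta}) (f_nondeg : nondegenerate f).
Implicit Types (a b c : F) (u v w x y : 'rV[F]_3).

Let char2 : 2%N \in [pchar F] := F4_pchar2 cardF.
Let thetaK a : theta (theta a) = a.
Proof. by rewrite !thetaE -exprM F4_exp4. Qed.

Lemma hformC x y : f x y = f y x ^+ 2.
Proof. by rewrite hermC expr0 mul1r thetaE. Qed.

Lemma hformZl a x y : f (a *: x) y = a * f x y.
Proof. exact: linearZl_LR. Qed.
Lemma hformZr a x y : f x (a *: y) = a ^+ 2 * f x y.
Proof. by rewrite linearZr_LR /= thetaE. Qed.
Lemma hformDl x y z : f (x + y) z = f x z + f y z.
Proof. exact: linearDl. Qed.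
Lemma hformDr x y z : f x (y + z) = f x y + f x z.
Proof. exact: linearDr. Qed.

Lemma hform_nondegenerate v : (forall x, f x v = 0) -> v = 0.
Proof.
move=> fv; apply/eqP; rewrite -memv0 -(eqP f_nondeg).
by apply/mem_orthovP => x _; rewrite hformC fv expr0n.
Qed.

Lemma form_diag x : f x x = (f x x != 0)%:R.
Proof.
have [-> //|nz] := eqVneq.
by apply: (mulfI nz); rewrite mulr1 -expr2 -hformC.
Qed.

Definition isotropic v := (v != 0) && (f v v == 0).

Definition form_col v : 'cV[F]_3 := \col_i f (delta_mx 0 i) v.

Lemma mul_form_col x v : x *m form_col v = (f x v)%:M.
Proof.
apply/matrixP=> i j; rewrite !ord1 !mxE eqxx mulr1n {2}[x]row_sum_delta linear_sumlz.
by apply: eq_bigr => k _; rewrite [RHS]hformZl mxE.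
Qed.

Lemma isotropic_orthogonal v w :
  isotropic v -> isotropic w -> f v w = 0 -> exists c, w = c *: v.
Proof.
(* Otherwise two matrices of rank 2 would have product 0 in dimension 3. *)
move=> /andP[v0 /eqP vv] /andP[w0 /eqP ww] vw.
have wv : f w v = 0 by rewrite hformC vw expr0n.
have [/existsP[c /eqP ->]|/existsPn indep] := boolP [exists c, w == c *: v].
  by exists c.
have free_vw a b : a *: v + b *: w = 0 -> a = 0 /\ b = 0.
  have [->|b0] := eqVneq b 0.
    by rewrite scale0r addr0 => /eqP; rewrite scaler_eq0 (negPf v0) orbF => /eqP.
  move=> /eqP; rewrite addr_eq0 => /eqP avw; case/eqP: (indep (- (a / b))).
  by rewrite scaleNr mulrC -scalerA avw scalerN scalerK ?opprK.
have ABz : col_mx v w *m row_mx (form_col v) (form_col w) = 0.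
  by rewrite mul_col_row !mul_form_col vv vw wv ww raddf0 block_mx0.
have := mulmx0_rank_max ABz.
have /eqP-> : row_free (col_mx v w).
  apply: inj_row_free => z; rewrite -[z]hsubmxK mul_row_col.
  rewrite [lsubmx z]mx11_scalar [rsubmx z]mx11_scalar !mul_scalar_mx.
  by case/free_vw=> -> ->; rewrite !raddf0 row_mx0.
suff /eqP : row_free (row_mx (form_col v) (form_col w))^T by rewrite mxrank_tr => ->.
apply: inj_row_free => z; rewrite tr_row_mx -[z]hsubmxK mul_row_col.
rewrite [lsubmx z]mx11_scalar [rsubmx z]mx11_scalar !mul_scalar_mx.
set a := lsubmx z 0 0; set b := rsubmx z 0 0 => abz.
(* The form is semilinear on the right, so a coefficient [a] outside becomes [theta a] inside,
   [theta] being an involution. *)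
have /hform_nondegenerate/free_vw : forall x, f x (theta a *: v + theta b *: w) = 0.
  move=> x; have := congr1 (mulmx x \o trmx) abz; rewrite /= trmx0 mulmx0.
  rewrite linearD !linearZ /= !trmxK mulmxDr -!scalemxAr !mul_form_col.
  rewrite hformDr !hformZr -!thetaE !thetaK => /matrixP/(_ 0 0).
  by rewrite !mxE eqxx !mulr1n.
case=> /eqP; rewrite fmorph_eq0 => /eqP a0 /eqP; rewrite fmorph_eq0 => /eqP b0.
by rewrite a0 b0 !raddf0 row_mx0.
Qed.

(** * Counting isotropic vectors *)

Lemma card_isotropic_or :
  #|[set v | isotropic v]| = 35%N \/ #|[set v | isotropic v]| = 27%N.
Proof.
(* The exponential sum S below satisfies S ^ 2 = 64. Its sign is left open: 35
   is excluded later, since a transvection has exactly three centers. *)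
pose sg c : int := (-1) ^+ (c != 0).
pose S := \sum_x sg (f x x).
have sgD c d : c = (c != 0)%:R -> d = (d != 0)%:R -> sg (c + d) = sg c * sg d.
  rewrite /sg => -> ->; case: (c != 0); case: (d != 0);
    by rewrite ?(addrr_pchar2 char2) ?addr0 ?add0r ?eqxx ?oner_eq0.
have add01 c d : c = (c != 0)%:R -> d = (d != 0)%:R -> c + d = (c + d != 0)%:R.
  move=> -> ->; case: (c != 0); case: (d != 0);
    by rewrite ?(addrr_pchar2 char2) ?addr0 ?add0r ?eqxx ?oner_eq0.
have tr01 c : c + c ^+ 2 = (c + c ^+ 2 != 0)%:R.
  have [-> //|c0] := eqVneq.
  apply: (mulfI c0); rewrite mulr1.
  have -> : (c + c ^+ 2) * (c + c ^+ 2) = c ^+ 2 + c ^+ 4 + 2%:R * c ^+ 3 by ring.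
  by rewrite (pcharf0 char2) mul0r addr0 F4_exp4 // addrC.
have fD x y : f (x + y) (x + y) = f x x + f y y + (f x y + f x y ^+ 2).
  by rewrite hformDl !hformDr (hformC y x); ring.
have sgK c : sg c * sg c = 1 by rewrite /sg -expr2 sqrr_sign.
(* Replacing the second variable by [x + y] cancels [f x x] and leaves [f y y] and the trace of
   [f x y]. *)
have SS : S * S = \sum_y sg (f y y) * \sum_x sg (f x y + f x y ^+ 2).
  transitivity (\sum_x \sum_y sg (f x x) * sg (f (x + y) (x + y))).
    rewrite {1}/S mulr_suml; apply: eq_bigr => x _.
    by rewrite /S (reindex_inj (addrI x)) mulr_sumr.
  rewrite exchange_big; apply: eq_bigr => y _; rewrite mulr_sumr.
  apply: eq_bigr => x _; rewrite fD sgD ?(sgD (f x x)) ?mulrA ?sgK ?mul1r //;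
    by [apply: add01; apply: form_diag | apply: form_diag].
have sg0 : sg 0 = 1 by rewrite /sg eqxx.
(* Translating by a vector [u] with [f u y] of trace 1 flips every sign; thus only [y = 0]
   contributes to [S * S], with [4 ^ 3 = 64] terms. *)
have inner y : y != 0 -> \sum_x sg (f x y + f x y ^+ 2) = 0.
  move=> y0.
  have [u fu] : exists u, f u y + f u y ^+ 2 = 1.
    have [u0 fu0] : exists u0, f u0 y != 0.
      apply/existsP; apply: contraR y0 => /existsPn fy.
      by apply/eqP/hform_nondegenerate => x; apply/eqP/negPn/fy.
    have [c c1] := F4_trace1 cardF.
    by exists ((c / f u0 y) *: u0); rewrite hformZl divfK.
  set T := \sum_x _; suff T0 : T = - T.
    have : T * 2 = 0 by rewrite mulr2n mulrDr mulr1 {1}T0 addNr.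
    by move/eqP; rewrite mulf_eq0 orbF => /eqP.
  rewrite {1}/T (reindex_inj (addrI u)) -sumrN; apply: eq_bigr => x _ /=.
  rewrite hformDl.
  have -> : f u y + f x y + (f u y + f x y) ^+ 2 =
    (f u y + f u y ^+ 2) + (f x y + f x y ^+ 2) + 2%:R * (f u y * f x y) by ring.
  by rewrite (pcharf0 char2) mul0r addr0 sgD -?tr01 // fu /sg oner_eq0 /= mulN1r.
have S64 : S * S = 64.
  rewrite SS (bigD1 0) //= [X in _ + X]big1 ?addr0 => [|y /inner->]; last first.
    by rewrite mulr0.
  rewrite linear0r sg0 mul1r (eq_bigr (fun=> 1)) => [|x _].
    by rewrite sumr_const [X in _ *+ X](card_mx F 1 3) cardF.
  by rewrite linear0r expr0n addr0 sg0.
pose N := #|[set v | isotropic v]|.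
have SN : S = (N.+1 * 2)%:R - 64.
  have -> : N.+1 = #|[set v | f v v == 0]|.
    rewrite (cardsD1 0) inE linear0r eqxx add1n; congr _.+1.
    by apply: eq_card => v; rewrite !inE.
  have -> : S = \sum_x ((f x x == 0)%:R * 2 - 1).
    by apply: eq_bigr => x _; rewrite /sg; case: (f x x == 0).
  rewrite sumrB -mulr_suml natrM -sum1_card natr_sum; congr (_ * _ - _).
    by rewrite big_mkcond [RHS]big_mkcond; apply: eq_bigr => x _; rewrite inE; case: ifP.
  by rewrite sumr_const [X in _ *+ X](card_mx F 1 3) cardF.
(* With [S = 2 (N + 1) - 64], the value 8 gives [N = 35] and -8 gives [N = 27]. *)
have : (S - 8) * (S + 8) = 0 by rewrite -subr_sqr expr2 S64.
rewrite -/N SN; move/eqP; rewrite mulf_eq0 => /orP[]/eqP; lia.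
Qed.

(** * Transvections and their relations *)

Definition transvection_mx v : 'M[F]_3 := 1%:M + form_col v *m v.

Lemma mul_transvection_mx x v : x *m transvection_mx v = x + f x v *: v.
Proof. by rewrite mulmxDr mulmx1 mulmxA mul_form_col mul_scalar_mx. Qed.

Lemma transvection_mxK v : f v v = 0 -> transvection_mx v *m transvection_mx v = 1%:M.
Proof.
move=> vv; apply: eq_mulmx_rV => x; rewrite mulmxA !mul_transvection_mx mulmx1.
rewrite hformDl hformZl vv.
by rewrite mulr0 addr0 -addrA -scalerDl (addrr_pchar2 char2) scale0r addr0.
Qed.

Definition is_transvection v (t : {'GL_3[F]}) : Prop :=
  forall x, x *m GLval t = x + f x v *: v.

(** The default 1 is taken only for a singular matrix; when [f v v = 0] the matrix is its own
    inverse. *)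
Definition transvection v : {'GL_3[F]} := insubd (1%g : {'GL_3[F]}) (transvection_mx v).

Lemma transvectionP v : f v v = 0 -> is_transvection v (transvection v).
Proof.
move=> vv x; rewrite /transvection val_insubd.
have -> : transvection_mx v \is a GRing.unit.
  by have := mulmx1_unit (transvection_mxK vv) => -[].
exact: mul_transvection_mx.
Qed.

Lemma transvection_eq v w t : is_transvection v t -> is_transvection w t ->
  v != 0 -> exists2 c, c != 0 & v = c *: w.
Proof.
move=> tEv tEw v0; have [x fxv] : exists x, f x v != 0.
  apply/existsP; apply: contraR v0 => /existsPn fv.
  by apply/eqP/hform_nondegenerate => x; apply/eqP/negPn/fv.
have := tEv x; rewrite tEw => /addrI /(congr1 ( *:%R (f x v)^-1)).
rewrite scalerK // scalerA => vE; exists ((f x v)^-1 * f x w) => //.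
by apply: contraNneq v0 => c0; rewrite -vE c0 scale0r.
Qed.

Lemma transvection_scale v c t : c != 0 ->
  is_transvection v t -> is_transvection (c *: v) t.
Proof.
by move=> c0 tE x; rewrite tE hformZr scalerA mulrAC -exprSr F4_exp3 // mul1r.
Qed.

Lemma GLval_ext (t s : {'GL_3[F]}) :
  (forall x : 'rV[F]_3, x *m GLval t = x *m GLval s) -> t = s.
Proof. by move=> ts; apply: val_inj; apply: eq_mulmx_rV. Qed.

Local Notation T := (unitary_transvections f).

Lemma unitary_transvectionsP t :
  reflect (exists2 v, isotropic v & is_transvection v t) (t \in T).
Proof.
rewrite inE; apply: (iffP existsP) => [[v /and3P[v0 vv /forallP tE]]|[v]].
  by exists v; rewrite /isotropic ?v0 // => x; apply/eqP.
move=> /andP[v0 vv] tE; exists v; rewrite v0 vv /=.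
by apply/forallP=> x; apply/eqP.
Qed.

(** The centers of a transvection are the three nonzero multiples of one vector, so the number of
    isotropic vectors is divisible by 3: it is 27, not 35. *)
Lemma card_unitary_transvections : #|T| = 9%N.
Proof.
suff : #|[set v | isotropic v]| = (#|T| * 3)%N by case: card_isotropic_or => ->; lia.
have imT : T = transvection @: [set v | isotropic v].
  apply/setP=> t; apply/unitary_transvectionsP/imsetP=> -[v].
    move=> iv tE; exists v; rewrite ?inE //; apply: GLval_ext => x.
    by rewrite tE transvectionP //; case/andP: iv => _ /eqP.
  rewrite inE => iv ->; exists v => //; apply: transvectionP.
  by case/andP: iv => _ /eqP.
rewrite -sum1_card (partition_big_imset transvection) /= -imT -sum_nat_const.
apply: eq_bigr => t /unitary_transvectionsP[v iv tE].
have [v0 /eqP vv] := andP iv.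
have card3 : #|[set~ (0 : F)%R]| = 3%N by rewrite cardsC1 cardF.
have v_inj : injective (fun c => c *: v).
  move=> c d /eqP; rewrite -subr_eq0 -scalerBl scaler_eq0 (negPf v0) orbF subr_eq0.
  by move/eqP.
rewrite sum1_card; transitivity #|[set c *: v | c in [set~ (0 : F)%R]]|; last first.
  by rewrite (card_imset _ v_inj).
apply: eq_card => w; rewrite [LHS]unfold_in inE.
apply/andP/imsetP => [[iw /eqP tw]|[c]].
  have [w0 /eqP ww] := andP iw; have := transvectionP ww; rewrite tw => tEw.
  by have [c c0 wE] := transvection_eq tEw tE w0; exists c; rewrite // ?inE.
rewrite !inE => c0 ->; rewrite /isotropic scaler_eq0 negb_or c0 v0 hformZl hformZr vv.
rewrite !mulr0 eqxx; split=> //; apply/eqP/GLval_ext => x.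
by rewrite (transvection_scale c0 tE) transvectionP // hformZl hformZr vv !mulr0.
Qed.

Lemma isotropic_form_neq0 v w t s : isotropic v -> isotropic w ->
  is_transvection v t -> is_transvection w s -> t != s -> f v w != 0.
Proof.
move=> iv iw tE sE; apply: contraNneq => /(isotropic_orthogonal iv iw)[c wE].
have c0 : c != 0.
  by apply: contraTneq iw => c0; rewrite wE c0 scale0r /isotropic eqxx.
by rewrite wE in sE; apply/eqP/GLval_ext => x; rewrite sE (transvection_scale c0 tE).
Qed.

Lemma transvection_invol t v : isotropic v -> is_transvection v t -> (t * t)%g = 1%g.
Proof.
move=> /andP[_ /eqP vv] tE; apply: GLval_ext => x.
rewrite GL_MxE mulmxA !tE hformDl hformZl vv GL_1E mulmx1.
by rewrite mulr0 addr0 -addrA -scalerDl (addrr_pchar2 char2) scale0r addr0.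
Qed.

Lemma transvection_braid t s :
  t \in T -> s \in T -> t != s -> (t * s * t = s * t * s)%g.
Proof.
move=> /unitary_transvectionsP[v iv tE] /unitary_transvectionsP[w iw sE] ts.
have fvw := isotropic_form_neq0 iv iw tE sE ts.
have [[_ /eqP vv] [_ /eqP ww]] := (andP iv, andP iw).
have a3 : f v w * f v w ^+ 2 = 1 by rewrite -exprS F4_exp3.
apply: GLval_ext => x; rewrite !GL_MxE !mulmxA.
have two c : c + c = 0 := addrr_pchar2 char2 c.
rewrite tE sE tE sE tE sE !(hformDl, hformZl) vv ww (hformC w v).
(* Both sides send [x] to [x + (p + r a^2) v + (r + p a) w], using [a^3 = 1] and characteristic
   2. *)
move: (f x v) (f x w) (f v w) a3 => p r a a3.
rewrite addrAC -(addrA x) -scalerDl.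
rewrite [RHS]addrAC -(addrA x (r *: w)) -scalerDl [RHS]addrAC.
congr (_ + _ *: v + _ *: w).
  have -> : p + (p + p * 0 + (r + p * a) * a ^+ 2) =
    r * a ^+ 2 + p * (a * a ^+ 2) + (p + p) by ring.
  by rewrite a3 two mulr1 addr0 addrC.
have -> : r + (r + r * 0 + (p + r * a ^+ 2) * a) =
  p * a + r * (a * a ^+ 2) + (r + r) by ring.
by rewrite a3 two mulr1 addr0 addrC.
Qed.

(** The determinant of an involution squares to 1, hence is 1 in characteristic 2; the two cross
    terms of the form are equal and cancel. *)
Lemma sub_transvections_SU3 : T \subset SU3 f.
Proof.
apply/subsetP=> t /unitary_transvectionsP[v iv tE]; have [_ /eqP vv] := andP iv.
rewrite inE; apply/andP; split.
  have /(congr1 (fun s : {'GL_3[F]} => \det (GLval s))) := transvection_invol iv tE.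
  rewrite GL_MxE det_mulmx GL_1E det1 => d2.
  move: (\det (GLval t)) d2 => d d2.
  suff : (d - 1) ^+ 2 == 0 by rewrite expf_eq0 subr_eq0.
  have -> : (d - 1) ^+ 2 = d * d - 1 + 2%:R * (1 - d) by ring.
  by rewrite d2 (pcharf0 char2) mul0r subrr addr0.
apply/forallP=> x; apply/forallP=> y; rewrite !tE.
rewrite !(hformDl, hformDr, hformZl, hformZr) vv (hformC v y).
apply/eqP; transitivity (f x y + 2%:R * (f x v * f y v ^+ 2)); first by ring.
by rewrite (pcharf0 char2) mul0r addr0.
Qed.

Lemma transvections_not_commuting t s : t \in T -> s \in T -> t != s ->
  exists2 r, r \in T & (t * s * r != r * s * t)%g.
Proof.
move=> Tt Ts ts; apply/exists_inP; apply: contraT.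
rewrite negb_exists_in => /forall_inP cTs.
have [v iv tE] := unitary_transvectionsP _ Tt.
have [w iw sE] := unitary_transvectionsP _ Ts.
have fvw := isotropic_form_neq0 iv iw tE sE ts; have [_ /eqP vv] := andP iv.
(* Otherwise all isotropic vectors would lie in the span of v and w. *)
have span_vw x : isotropic x -> exists a b, x = a *: v + b *: w.
  move=> ix; have [fwx|fwx] := eqVneq (f w x) 0.
    have [c ->] := isotropic_orthogonal iw ix fwx.
    by exists 0, c; rewrite scale0r add0r.
  have [_ /eqP xx] := andP ix; have rE := transvectionP xx; set r := transvection x in rE.
  have Tr : r \in T by apply/unitary_transvectionsP; exists x.
  (* As [t] fixes [v], comparing the two images of [v] writes [f v w * f w x] times [x] as a
     combination of [v] and [w], and this scalar is nonzero. *)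
  have : v *m GLval (t * s * r)%g = v *m GLval (r * s * t)%g.
    by rewrite (eqP (negPn (cTs r Tr))).
  rewrite !GL_MxE !mulmxA !(tE, sE, rE) !(hformDl, hformZl) vv.
  rewrite !(mul0r, scale0r, addr0, add0r) scalerDl -!addrA => /addrI.
  rewrite [X in X = _ -> _]addrCA => /addrI/esym/eqP.
  rewrite [X in _ == X]addrC -subr_eq => /eqP.
  set k := _ * f w x; have k0 : k != 0 by rewrite mulf_neq0.
  move/(congr1 ( *:%R k^-1)); rewrite scalerK // => <-.
  rewrite addrAC -scalerBl addrC scalerDr !scalerA; eexists; eexists; reflexivity.
(* The span has at most 16 vectors, fewer than both possible numbers of isotropic vectors. *)
have : (#|[set x | isotropic x]| <= 16)%N.
  have <- : #|{: F * F}| = 16%N by rewrite card_prod cardF.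
  rewrite -cardsT; apply: leq_trans (leq_imset_card (fun ab => ab.1 *: v + ab.2 *: w) _).
  apply: subset_leq_card; apply/subsetP=> x; rewrite inE => /span_vw[a [b ->]].
  by apply/imsetP; exists (a, b).
by case: card_isotropic_or => ->.
Qed.

Lemma transvections_mod_center (Z := 'Z((SU3 f)^`(1))%g) :
  #|(T / Z)%g| = 9%N /\
  {in (T / Z)%g &, forall c d : coset_of Z, c != d -> #[c * d]%g = 3%N}.
Proof.
rewrite -card_unitary_transvections; apply: (quotient_center_der1_braiding (S := SU3_group f)).
- exact: sub_transvections_SU3.
- by move=> t /unitary_transvectionsP[v iv tE]; apply: transvection_invol iv tE.
- exact: transvection_braid.
- exact: transvections_not_commuting.
Qed.
End Transvections.

(** * The spectrum *)

Theorem proposition6p13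
  (F : finFieldType) (cardF : #|F| = 4)
  (theta : {rmorphism F -> F}) (thetaE : forall a : F, theta a = (a ^+ 2)%R)
  (f : {hermitian_sym 'rV[F]_3 for theta}%R) (f_nondeg : nondegenerate f)
  (h : nat)
  (gT : finGroupType) (G : {group gT}) (D : {set gT})
  (trG : is_3transposition_group G D)
  (typeG : exists (hT : finGroupType) (H : {group hT}) (E : {set hT}),
     [/\ is_3transposition_group H E,
         has_type 2 2 H E ((SU3 f)^`(1))%G (unitary_transvections f)
       & has_type 3 (2 * h) G D H E]) :
  #|D| = (36 * 3 ^ (2 * h))%N /\
  diagram_spectrum D (33 * 3 ^ (2 * h) - 1)%N
    [:: ((3 ^+ (2 * h) - 1)%R, 27%N); ((- 3 ^+ (2 * h + 1) - 1)%R, 8%N)]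
    (- 1)%R.
Proof.
have [cardT T3] := transvections_mod_center cardF thetaE f_nondeg.
case: typeG => hT [H [E [trH tyH tyG]]].
have [|phi [imE fibE ordE eltE]] := has_type_quotient trH tyH.
  by rewrite [#|_|]cardT.
have cardE : #|E| = 36 by rewrite (card_fibres fibE) imE [#|_|]cardT.
have [|eta [imD fibD ordD eltD]] := has_type_lift trG trH tyG; first by rewrite cardE.
set q := (3 ^ (2 * h))%N in fibD *.
have q_gt0 : (0 < q)%N by rewrite expn_gt0.
have cardD : #|D| = (36 * q)%N by rewrite (card_fibres fibD) imD cardE.
have etaE d : d \in D -> eta d \in E by rewrite -imD; apply: imset_f.
(* Blocks are the fibres of [eta] over the 36 elements of [E]; the 9 classes are the fibres of
   [kappa]. *)
pose kappa d := phi (eta d).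
have fibK : {in D, forall d, #|[set e in D | kappa e == kappa d]| = (4 * q)%N}.
  move=> d Dd; rewrite -[4%N]/(2 ^ 2)%N -(fibE _ (etaE d Dd)).
  rewrite (card_fibres (phi := eta) (c := q)).
    congr (_ * _)%N; apply: eq_card => y; rewrite inE -imD.
    apply/imsetP/andP => [[e]|[/imsetP[e De ->] ye]].
      by rewrite inE => /andP[De ke] ->; rewrite imset_f.
    by exists e; rewrite // inE De.
  move=> e; rewrite inE => /andP[De /eqP ke]; rewrite -(fibD e De).
  apply: eq_card => y; rewrite !inE -ke /kappa.
  by case: (eta y =P eta e) => [->|]; rewrite ?eqxx ?andbT ?andbF.
(* In one block the product is a nontrivial 3-element, so has order 3. In one class but different
   blocks its order is that of a 2-element. Across classes the order 3 is inherited from the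
   transvections. *)
have adjE : {in D &, forall d e,
    adjacent d e = (d != e) && ((eta d == eta e) || (kappa d != kappa e))}.
  move=> d e Dd De; have [_ _ D2 D3] := trG; rewrite /adjacent.
  have [<-|de] /= := eqVneq d e; first by rewrite (involution_mulg (D2 d Dd)) order1.
  have de1 : #[d * e] != 1%N.
    by rewrite order_eq1 -eq_invg_mul (involution_inv (D2 d Dd)).
  have [eta_de|eta_de] /= := eqVneq (eta d) (eta e).
    have := eltD d e Dd De eta_de; have := D3 d e Dd De.
    by rewrite !inE (negPf de1) /p_elt /= => /orP[]/eqP->.
  rewrite -(ordD d e) //; have [k_de|k_de] /= := eqVneq (kappa d) (kappa e).
    have := eltE _ _ (etaE d Dd) (etaE e De) k_de; rewrite /p_elt.
    by case: eqP => // ->.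
  by rewrite -(ordE _ _ (etaE d Dd) (etaE e De) k_de) T3 // -imE imset_f ?etaE.
split=> //; split.
  (* The neighbours are the [q - 1] others in the block and the [36q - 4q] vertices outside the
     class. *)
  move=> d Dd; pose B := [set e in D | eta e == eta d].
  pose K := [set e in D | kappa e == kappa d].
  have -> : [set e in D | adjacent d e] = (B :\ d) :|: (D :\: K).
    apply/setP=> e; rewrite !inE; case De: (e \in D); rewrite ?andbF //= adjE //.
    rewrite !andbT (eq_sym d) (eq_sym (eta d)) (eq_sym (kappa d)).
    by case: (e =P d) => [->|] //=; rewrite eqxx.
  have sKD : K \subset D by rewrite /K setIdE subsetIl.
  rewrite cardsU (cardsD D) (setIidPr sKD) cardD.
  have := fibD d Dd; rewrite -/B (cardsD1 d) inE Dd eqxx /= => cB.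
  have -> : (B :\ d) :&: (D :\: K) = set0.
    apply/setP=> e; rewrite !inE /kappa; case: (eta e =P eta d) => [->|_].
      by rewrite eqxx andbT; case: (e \in D); rewrite ?andbF.
    by rewrite !andbF.
  by rewrite cards0 /K fibK //; lia.
(* The listed multiplicities 1, 27 and 8 add up to 36; for [h = 0] no further copy of -1 remains. *)
exists (#|D| - 36)%N.
pose Bi : rel 'I_#|D| := fun i j => eta (enum_val j) == eta (enum_val i).
pose Ki : rel 'I_#|D| := fun i j => kappa (enum_val j) == kappa (enum_val i).
have -> : diagram_mx D = (\matrix_(i, j) ((i != j) && (Bi i j || ~~ Ki i j))%:R)%R.
  apply/matrixP=> i j; rewrite !mxE adjE ?enum_valP // (inj_eq enum_val_inj).
  by rewrite /Bi /Ki (eq_sym (eta _)) (eq_sym (kappa _)).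
rewrite (char_poly_three_equivalences _ q_gt0 cardD); last first.
- by move=> i; rewrite -(fibD _ (enum_valP i)) -card_enum_val_pred.
- by move=> i; rewrite -(fibK _ (enum_valP i)) -card_enum_val_pred.
- by move=> i j; rewrite /Bi /Ki /kappa => /eqP->.
- by move=> i j l; rewrite /Bi eqxx; split=> // /eqP->.
- by move=> i j l; rewrite /Ki eqxx; split=> // /eqP->.
rewrite big_cons prod_tally_seq !big_cons big_nil /=.
have -> : ((33 * q - 1)%:R = 33 * q%:R - 1 :> algC)%R.
  by rewrite natrB ?natrM //; lia.
have -> : (3 ^+ (2 * h + 1) = 3 * q%:R :> algC)%R by rewrite addn1 exprS natrX.
rewrite -natrX -/q -mulNr mulr1.
move: (_ ^+ 8)%R (_ ^+ 27)%R (_ ^+ (#|D| - 36))%R => x y z.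
by rewrite -!mulrA (mulrCA x).
Qed.
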